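(* Let $(S,+,\cdot)$ be a symmetric weak left brace. Then $-x+x=xx^{-1}$ and $x-x=x^{-1}x$ for all $x\in S$. As a consequence, $(S,+,\cdot)$ is a dual weak left brace.
   Context: A semigroup $(S,+)$ (not necessarily commutative) is an inverse semigroup if for each $a\in S$ there is a unique element $-a$ with $a-a+a=a$ and $-a+a-a=-a$; for an inverse semigroup $(S,\cdot)$ written multiplicatively this element is written $a^{-1}$. An inverse semigroup $(S,\cdot)$ is a Clifford semigroup if $a^{-1}a=aa^{-1}$ for all $a$. Juxtaposition denotes $\cdot$. A symmetric weak left brace is a triple $(S,+,\cdot)$ with $(S,+)$ and $(S,\cdot)$ inverse semigroups such that $x(y+z)=xy-x+xz$ and $x+(yz)=(x+y)x^{-1}(x+z)$ for all $x,y,z\in S$. A weak left brace is a triple $(S,+,\cdot)$ with $(S,+)$ and $(S,\cdot)$ inverse semigroups such that $x(y+z)=xy-x+xz$ and $xx^{-1}=-x+x$ for all $x,y,z\in S$. It is a dual weak left brace if moreover $(S,\cdot)$ is a Clifford semigroup. *)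

(* Defs.v *)
From mathcomp Require Import ssreflect ssrfun ssrnotations.

Set Implicit Arguments.
Unset Strict Implicit.
Unset Printing Implicit Defensive.

Section InverseSemigroup.

Variables (S : Type) (op : S -> S -> S) (inv : S -> S).

Definition is_inverse (a b : S) : Prop :=
  op (op a b) a = a /\ op (op b a) b = b.

(* The inversion map is carried as data; [inverse_unique] determines it from
   [op]. *)
Record inverse_semigroup : Prop := InverseSemigroup {
  inverse_semigroup_assoc : associative op;
  inverse_unique : forall a : S, unique (is_inverse a) (inv a)
}.

Record clifford_semigroup : Prop := CliffordSemigroup {
  clifford_inverse_semigroup : inverse_semigroup;
  clifford_comm : forall a : S, op (inv a) a = op a (inv a)
}.

End InverseSemigroup.

Section WeakBraces.

Variables (S : Type) (add : S -> S -> S) (opp : S -> S).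
Variables (mul : S -> S -> S) (inv : S -> S).

Local Notation "x + y" := (add x y).
Local Notation "- x" := (opp x).
Local Notation "x - y" := (add x (opp y)).
Local Notation "x * y" := (mul x y).
Local Notation "x ^-1" := (inv x).

Record symmetric_weak_left_brace : Prop := SymmetricWeakLeftBrace {
  swlb_add : inverse_semigroup add opp;
  swlb_mul : inverse_semigroup mul inv;
  swlb_mulD : forall x y z : S, x * (y + z) = x * y - x + x * z;
  swlb_addM : forall x y z : S, x + y * z = (x + y) * x^-1 * (x + z)
}.

Record weak_left_brace : Prop := WeakLeftBrace {
  wlb_add : inverse_semigroup add opp;
  wlb_mul : inverse_semigroup mul inv;
  wlb_mulD : forall x y z : S, x * (y + z) = x * y - x + x * z;
  wlb_mulV : forall x : S, x * x^-1 = - x + x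
}.

Record dual_weak_left_brace : Prop := DualWeakLeftBrace {
  dwlb_weak_left_brace : weak_left_brace;
  dwlb_clifford : clifford_semigroup mul inv
}.

End WeakBraces.

(* Main.v *)
(** The axioms are invariant under exchanging addition with multiplication. If [e] is
    a multiplicative idempotent and [a = e + e], the second axiom gives
    [a = a * e * a], whence [e * a = a], while the first gives [e * a = e]; so, by
    duality, both operations have the same idempotents, and on them they coincide.
    Expanding [x * x^-1 = x * (x^-1 - x^-1 + x^-1)] by the first axiom shows that
    [x * x^-1] lies below both [- x + x] and [x - x]. Dually [x - x] lies below
    both [x^-1 * x] and [x * x^-1], and replacing [x] by [- x] or [x^-1] gives the
    reverse inequalities. *)
From mathcomp Require Import ssreflect ssrfun.
Require Import Defs.

Set Implicit Arguments.
Unset Strict Implicit.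
Unset Printing Implicit Defensive.

Section InverseSemigroupTheory.

Variables (S : Type) (op : S -> S -> S) (inv : S -> S).
Hypothesis HS : inverse_semigroup op inv.

Local Notation "x * y" := (op x y).

Let opA : associative op := inverse_semigroup_assoc HS.

Lemma is_inverse_inv a : is_inverse op a (inv a).
Proof. by case: (inverse_unique HS a). Qed.

Lemma is_inverse_eq a b : is_inverse op a b -> inv a = b.
Proof. by case: (inverse_unique HS a) => _; apply. Qed.

Lemma op_inv_op a : a * inv a * a = a.
Proof. by case: (is_inverse_inv a). Qed.

Lemma inv_op_inv a : inv a * a * inv a = inv a.
Proof. by case: (is_inverse_inv a). Qed.

Lemma is_inverse_sym a b : is_inverse op a b -> is_inverse op b a.
Proof. by case. Qed.

Lemma inv_involutive : involutive inv.
Proof. by move=> a; apply/is_inverse_eq/is_inverse_sym/is_inverse_inv. Qed.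

Lemma inv_idem e : e * e = e -> inv e = e.
Proof. by move=> ee; apply: is_inverse_eq; split; rewrite !ee. Qed.

Lemma idem_op_inv a : (a * inv a) * (a * inv a) = a * inv a.
Proof. by rewrite opA op_inv_op. Qed.

Lemma idem_inv_op a : (inv a * a) * (inv a * a) = inv a * a.
Proof. by rewrite opA inv_op_inv. Qed.

Lemma idem_of_inverse a b : is_inverse op a b -> b * b = b -> a = b.
Proof.
by move=> ab bb; rewrite -(is_inverse_eq (is_inverse_sym ab)) inv_idem.
Qed.

(** With [c] the inverse of [e * f], the idempotent [f * c * e] is also an inverse of [e * f], so
    [c = f * c * e] by uniqueness; an element with an idempotent inverse equals it. *)
Lemma idem_op e f : e * e = e -> f * f = f -> (e * f) * (e * f) = e * f.
Proof.
move=> ee ff; set c := inv (e * f).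
have [h1 h2] : is_inverse op (e * f) c := is_inverse_inv _.
have fce : f * c * e * f * c * e = f * c * e.
  by rewrite -[in RHS]h2 !opA.
have cE : c = f * c * e.
  apply: is_inverse_eq; split.
    by rewrite !opA -(opA e f f) ff -(opA _ e e) ee -[RHS]h1 !opA.
  by rewrite !opA -(opA _ e e) ee -(opA _ f f) ff.
have cc : c * c = c by rewrite cE !opA.
by rewrite (idem_of_inverse (conj h1 h2) cc).
Qed.

(** Both products are idempotent, and [f * e] is an inverse of [e * f]. *)
Lemma idem_comm e f : e * e = e -> f * f = f -> e * f = f * e.
Proof.
move=> ee ff.
have ef := idem_op ee ff; have fe := idem_op ff ee.
apply: (idem_of_inverse _ fe); split.
  by rewrite !opA -(opA e f f) ff -(opA _ e e) ee -opA.
by rewrite !opA -(opA f e e) ee -(opA _ f f) ff -opA.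
Qed.

(** The element [e * a * e] is an idempotent inverse of [a], hence equals [a]. *)
Lemma idem_absorb a e : e * e = e -> a * e * a = a -> e * a = a.
Proof.
move=> ee aea.
have eaea : e * a * e * a = e * a by rewrite -!opA (opA a) aea.
have bb : (e * a * e) * (e * a * e) = e * a * e.
  by rewrite !opA -(opA _ e e) ee eaea.
have aE : a = e * a * e.
  apply: (idem_of_inverse _ bb); split; first by rewrite !opA aea aea.
  by rewrite !opA !eaea.
by rewrite {1}aE !opA ee -aE.
Qed.

(** The idempotent [inv x * x] commutes with [e] and is absorbed by the factor [inv x] next to
    it. *)
Lemma idem_right_absorb x e w : e * e = e -> e = e * inv x * w ->
  e * (inv x * x) = e.
Proof.
move=> ee eE; have ff := idem_inv_op x.
by rewrite (idem_comm ee ff) {1}eE !opA -(idem_comm ee ff) -(opA e)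
  inv_op_inv -eE.
Qed.

Lemma idem_left_absorb x e w : e * e = e -> e = w * inv x * e ->
  e * (x * inv x) = e.
Proof.
move=> ee eE; have ff := idem_op_inv x.
by rewrite {1}eE -(opA _ e) (idem_comm ee ff) !opA -(opA w) -(opA w) inv_op_inv -eE.
Qed.

End InverseSemigroupTheory.

Lemma symmetric_weak_left_brace_dual S (add : S -> S -> S) opp mul inv :
  symmetric_weak_left_brace add opp mul inv ->
  symmetric_weak_left_brace mul inv add opp.
Proof. by case. Qed.

Section SymmetricWeakLeftBrace.

Variables (S : Type) (add : S -> S -> S) (opp : S -> S).
Variables (mul : S -> S -> S) (inv : S -> S).
Hypothesis HS : symmetric_weak_left_brace add opp mul inv.

Local Notation "x + y" := (add x y).
Local Notation "- x" := (opp x).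
Local Notation "x - y" := (add x (opp y)).
Local Notation "x * y" := (mul x y).
Local Notation "x ^-1" := (inv x).

Let HA := swlb_add HS.
Let HM := swlb_mul HS.

Lemma mul_idem_add e : e * e = e -> e + e = e.
Proof.
move=> ee; have ea : e * (e + e) = e + e.
  apply: (idem_absorb HM) => //.
  by move: (swlb_addM HS e e e); rewrite ee (inv_idem HM ee).
by rewrite -ea (swlb_mulD HS) ee (op_inv_op HA).
Qed.

Lemma mul_add_idem e f : e + e = e -> f + f = f -> e * e = e -> f * f = f ->
  e * (e + f) = e + f.
Proof.
move=> e2 f2 ee ff; apply: (idem_absorb HM) => //.
(* The second axiom at [y = z = f] reads [a = a * e * a] for [a = e + f]. *)
by move: (swlb_addM HS e f f); rewrite ff (inv_idem HM ee).
Qed.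

Lemma mulV_expand x : x * x^-1 = x * x^-1 - x + x * - x^-1 - x + x * x^-1.
Proof. by rewrite -!(swlb_mulD HS) (op_inv_op HA). Qed.

(** The expansion starts with [x * x^-1 - x]; its other end, [- x + x * x^-1], serves for
    [x - x]. *)
Lemma mulV_add_oppr x : x * x^-1 + (- x + x) = x * x^-1.
Proof.
apply: (idem_right_absorb HA (w := x * - x^-1 - x + x * x^-1)).
  exact/mul_idem_add/(idem_op_inv HM).
by rewrite {1}mulV_expand !(inverse_semigroup_assoc HA).
Qed.

Lemma mulV_add_subr x : x * x^-1 + (x - x) = x * x^-1.
Proof.
apply: (idem_left_absorb HA (w := x * x^-1 - x + x * - x^-1)).
  exact/mul_idem_add/(idem_op_inv HM).
exact: mulV_expand.
Qed.

End SymmetricWeakLeftBrace.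

Section Idempotents.

Variables (S : Type) (add : S -> S -> S) (opp : S -> S).
Variables (mul : S -> S -> S) (inv : S -> S).
Hypothesis HS : symmetric_weak_left_brace add opp mul inv.

Local Notation "x + y" := (add x y).
Local Notation "- x" := (opp x).
Local Notation "x - y" := (add x (opp y)).
Local Notation "x * y" := (mul x y).
Local Notation "x ^-1" := (inv x).

Let HA := swlb_add HS.
Let HM := swlb_mul HS.
Let HD := symmetric_weak_left_brace_dual HS.

(** Both sides equal [e + e * f]: the first axiom expands [e + f = e * (e + f)] to it, and dual
    absorption reduces it to [e * f]. *)
Lemma idem_mul_add e f : e * e = e -> f * f = f -> e * f = e + f.
Proof.
move=> ee ff; have e2 := mul_idem_add HS ee; have f2 := mul_idem_add HS ff.
rewrite -(mul_add_idem HS) // (swlb_mulD HS) ee (inv_idem HA e2) e2.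
by rewrite (mul_add_idem HD).
Qed.

Lemma subr_eq_mulV x : x - x = x * x^-1.
Proof.
have kk := mul_idem_add HD (idem_op_inv HA x).
have ee := idem_op_inv HM x.
(* Antisymmetry: the sum and the product of the two idempotents agree, so each idempotent absorbs
   the other. *)
rewrite -(mulV_add_subr HS) -(idem_mul_add ee kk) (idem_comm HM ee kk).
by rewrite (mulV_add_subr HD).
Qed.

Lemma oppr_eq_subr x : - x + x = x - x.
Proof.
have le y : (y - y) + (- y + y) = y - y.
  by rewrite subr_eq_mulV (mulV_add_oppr HS).
rewrite -[RHS]le (idem_comm HA (idem_op_inv HA x) (idem_inv_op HA x)).
(* At [- x] the two idempotents trade places, which gives the reverse inequality. *)
by move: (le (- x)); rewrite (inv_involutive HA).
Qed.

End Idempotents.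

Theorem proposition4p2 (S : Type) (add : S -> S -> S) (opp : S -> S)
    (mul : S -> S -> S) (inv : S -> S)
    (HS : symmetric_weak_left_brace add opp mul inv) :
  (forall x : S, add (opp x) x = mul x (inv x) /\
                 add x (opp x) = mul (inv x) x) /\
  dual_weak_left_brace add opp mul inv.
Proof.
have HD := symmetric_weak_left_brace_dual HS.
(* Read in the dual brace, the additive identity is the Clifford condition. *)
have mulVC x : mul (inv x) x = mul x (inv x) by exact: oppr_eq_subr HD x.
have mulVE x : add (opp x) x = mul x (inv x).
  by rewrite (oppr_eq_subr HS) (subr_eq_mulV HS).
split; first by move=> x; rewrite mulVC (subr_eq_mulV HS) mulVE.
case: HS => HA HM mulD _; split; last by split.
by split=> // x; rewrite mulVE.
Qed.
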